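(* Let $S$ be a range set. Let $X$ be an $S$-valued ultrametrizable topological space, and let $A$ be a closed subset of $X$. Then for every $e\in \mathrm{UM}(A,S)$ there exists $D\in\mathrm{UM}(X,S)$ with $D|_{A^2}=e$. Moreover, if $X$ is completely metrizable and $e\in\mathrm{UM}(A,S)$ is complete, then $D$ can be chosen to be a complete $S$-valued ultrametric.
   Context: A range set is a set $S\subseteq[0,\infty)$ with $0\in S$. A metric $d$ on $X$ is an ultrametric if $d(x,y)\le \max\{d(x,z),d(z,y)\}$ for all $x,y,z$; it is $S$-valued if $d(X^2)\subseteq S$. For a topological space $X$, $\mathrm{UM}(X,S)$ denotes the set of all $S$-valued ultrametrics on $X$ that generate the topology of $X$; $X$ is $S$-valued ultrametrizable if $\mathrm{UM}(X,S)\neq\emptyset$. Subsets carry the subspace topology. *)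

(* Defs.v *)
From HB Require Import structures.
From mathcomp Require Import all_boot all_order all_algebra.
From mathcomp Require Import all_classical all_reals all_analysis.

Set Implicit Arguments.
Unset Strict Implicit.
Unset Printing Implicit Defensive.

Import Order.TTheory GRing.Theory Num.Theory.

#[global] Open Scope classical_set_scope.
#[global] Open Scope ring_scope.

Definition range_set (R : realType) (S : set R) : Prop :=
  (forall s, S s -> 0 <= s) /\ S 0.

(* Metrics are functions rather than instances of [metricType], since several
   metrics on one and the same topological space have to be compared. *)
Record is_metric (R : realType) (T : Type) (d : T -> T -> R) : Prop := {
  is_metric_ge0 : forall x y, 0 <= d x y ;
  is_metric_eq0 : forall x y, d x y = 0 <-> x = y ;
  is_metric_sym : forall x y, d x y = d y x ;
  is_metric_triangle : forall x y z, d x y <= d x z + d z y }.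

Definition is_ultrametric (R : realType) (T : Type) (d : T -> T -> R) : Prop :=
  is_metric d /\ forall x y z, d x y <= Num.max (d x z) (d z y).

Definition valued_in (R : realType) (T : Type) (S : set R)
    (d : T -> T -> R) : Prop :=
  forall x y, S (d x y).

Definition generates_topology (R : realType) (X : topologicalType)
    (d : X -> X -> R) : Prop :=
  forall U : set X,
    open U <-> forall x, U x -> exists2 r : R, 0 < r & [set y | d x y < r] `<=` U.

Definition UM (R : realType) (X : topologicalType) (S : set R) :
    set (X -> X -> R) :=
  [set d | [/\ is_ultrametric d, valued_in S d & generates_topology d]].
Arguments UM {R} X S.

Definition ultrametrizable (R : realType) (X : topologicalType)
    (S : set R) : Prop :=
  UM X S !=set0.
Arguments ultrametrizable {R} X S.

Definition complete_metric (R : realType) (T : Type) (d : T -> T -> R) : Prop :=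
  forall u : nat -> T,
    (forall eps : R, 0 < eps ->
       exists N, forall m n, (N <= m)%N -> (N <= n)%N -> d (u m) (u n) < eps) ->
    exists x, forall eps : R, 0 < eps ->
      exists N, forall n, (N <= n)%N -> d (u n) x < eps.

Definition completely_metrizable (R : realType) (X : topologicalType) : Prop :=
  exists d : X -> X -> R,
    [/\ is_metric d, generates_topology d & complete_metric d].
Arguments completely_metrizable R X : clear implicits.

(* [set_type A] is the subtype of points of [A]; the library equips it with the
   subspace topology, the initial topology of the inclusion [set_val]. *)
Definition extends (R : realType) (X : Type) (A : set X)
    (D : X -> X -> R) (e : set_type A -> set_type A -> R) : Prop :=
  forall a b : set_type A, D (set_val a) (set_val b) = e a b.

(* Main.v *)
(** Coarsening an ultrametric of [UM X S] to one whose positive values form a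
    nonincreasing sequence makes every point of [X] have a nearest point in [A].
    Choosing it as a function of the set of all nearest points gives a
    1-Lipschitz retraction [r] of [X] onto [A], and with [gap x := d x (r x)],
      [D x y := max (e (r x) (r y)) (min (d x y) (max (gap x) (gap y)))]
    extends [e].  If [X] has a complete metric [rho], the coarsening is done along
    balls of small [rho]-diameter, so that [d], and then [D], is complete. *)

Require Import Defs.
From HB Require Import structures.
From mathcomp Require Import all_boot all_order all_algebra.
From mathcomp Require Import all_classical all_reals all_analysis.

Set Implicit Arguments.
Unset Strict Implicit.
Unset Printing Implicit Defensive.

Import Order.TTheory GRing.Theory Num.Theory.

Local Open Scope classical_set_scope.
Local Open Scope ring_scope.

(** * Comparison of metrics and of the topologies they generate *)

Definition finer (R : realType) (T : Type) (d e : T -> T -> R) : Prop :=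
  forall x eps, 0 < eps ->
    exists2 eta, 0 < eta & forall y, d x y < eta -> e x y < eps.

Definition cauchy_for (R : realType) (T : Type) (d : T -> T -> R)
    (u : nat -> T) : Prop :=
  forall eps : R, 0 < eps ->
    exists N, forall m n, (N <= m)%N -> (N <= n)%N -> d (u m) (u n) < eps.

Section Metrics.
Context {R : realType}.

Lemma is_metric_xx (T : Type) (d : T -> T -> R) :
  is_metric d -> forall x, d x x = 0.
Proof. by move=> md x; apply/(is_metric_eq0 md). Qed.

Lemma generates_finer (X : topologicalType) (d e : X -> X -> R) :
  generates_topology d -> is_metric e -> generates_topology e -> finer d e.
Proof.
move=> gd me ge x eps eps0.
have oB : open [set y | e x y < eps].
  apply/ge => y /= xy; exists (eps - e x y); first by rewrite subr_gt0.
  move=> z /= yz; rewrite (le_lt_trans (is_metric_triangle me x z y))//.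
  by rewrite -ltrBrDl.
have xB : [set y | e x y < eps] x by rewrite /= (is_metric_xx me).
by have [r r0 rB] := (gd _).1 oB x xB; exists r.
Qed.

Lemma finer_generates (X : topologicalType) (d e : X -> X -> R) :
  generates_topology d -> finer d e -> finer e d -> generates_topology e.
Proof.
move=> gd de ed U; rewrite (gd U); split=> oU x /oU[r r0 rU].
- by have [t t0 tr] := ed x r r0; exists t => // y /= /tr /rU.
- by have [t t0 tr] := de x r r0; exists t => // y /= /tr /rU.
Qed.

Lemma is_metric_sub (T : Type) (A : set T) (d : T -> T -> R) :
  is_metric d -> is_metric (fun a b : set_type A => d (set_val a) (set_val b)).
Proof.
move=> md; split=> [a b|a b|a b|a b c]; [exact: is_metric_ge0| |exact: is_metric_sym|].
  by split=> [/(is_metric_eq0 md)/val_inj|->]; last exact: is_metric_xx.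
exact: is_metric_triangle.
Qed.

Lemma generates_subspace (X : topologicalType) (A : set X) (d : X -> X -> R) :
  is_metric d -> generates_topology d ->
  generates_topology (fun a b : set_type A => d (set_val a) (set_val b)).
Proof.
move=> md gd U; split.
- case=> V oV VU a; rewrite -VU /= => Va.
  by have /gd/(_ _ Va)[r r0 rV] := oV; exists r => // b /= /rV.
- move=> oU.
  (* [V] is the union of the [d]-balls of [X] centred in [A] whose trace on [A] lies in [U]. *)
  pose V := [set y | exists (a : set_type A) r,
    [set b | d (set_val a) (set_val b) < r] `<=` U /\ d (set_val a) y < r].
  exists V.
    apply/gd => y [a [r [rU ay]]].
    exists (r - d (set_val a) y); first by rewrite subr_gt0.
    move=> z /= yz; exists a, r; split=> //.
    rewrite (le_lt_trans (is_metric_triangle md (set_val a) z y))//.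
    by rewrite -ltrBrDl.
  apply/seteqP; split=> [b [a [r [rU ab]]]|b Ub]; first exact: rU.
  have [r r0 rU] := oU _ Ub; exists b, r; split=> //.
  by rewrite (is_metric_xx md).
Qed.

Lemma closed_gap (X : topologicalType) (A : set X) (d : X -> X -> R) x :
  generates_topology d -> closed A -> ~ A x ->
  exists2 r, 0 < r & forall a, A a -> r <= d x a.
Proof.
move=> gd /closed_openC oA Ax.
have /gd/(_ _ Ax)[r r0 rA] := oA; exists r => // a Aa.
by rewrite leNgt; apply/negP => /rA.
Qed.

Lemma invS_lt (eps : R) : 0 < eps -> exists n, n.+1%:R^-1 < eps.
Proof.
move=> eps0; have eps'0 : 0 <= eps^-1 by rewrite invr_ge0 ltW.
exists (Num.truncn eps^-1).
rewrite -[ltRHS]invrK ltf_pV2 ?posrE ?invr_gt0 ?ltr0n//.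
by rewrite truncnS_gt.
Qed.

(** An [e]-Cauchy sequence is [d]-Cauchy, so it has a [d]-limit, which [finer d e] turns into an
    [e]-limit. *)
Lemma complete_transfer (T : Type) (d e : T -> T -> R) :
  is_metric d -> is_metric e -> finer d e ->
  (forall u, cauchy_for e u -> cauchy_for d u) ->
  complete_metric d -> complete_metric e.
Proof.
move=> md me de edC cd u /edC /cd[x ux]; exists x => eps /(de x)[t t0 tE].
have [N uN] := ux _ t0; exists N => n /uN.
by rewrite (is_metric_sym md) (is_metric_sym me); exact: tE.
Qed.

Lemma ultrametric_isosceles (T : Type) (d : T -> T -> R) x y z :
  is_ultrametric d -> d x y < d x z -> d y z = d x z.
Proof.
move=> [md ud] xyz; apply/eqP; rewrite eq_le; apply/andP; split.
  rewrite (le_trans (ud y z x))// ge_max lexx andbT.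
  by rewrite (is_metric_sym md) ltW.
by have := ud x z y; rewrite le_max leNgt xyz.
Qed.

(* The second alternative covers range sets with [0] as an isolated point, for
   which [X] is discrete. *)
Lemma range_set_sequence (S : set R) t : S t -> 0 < t ->
  exists s : nat -> R, [/\ forall n, S (s n), forall n, 0 < s n,
    forall m n, (m <= n)%N -> s n <= s m &
    (forall eps, 0 < eps -> exists n, s n < eps) \/
    (exists2 eta, 0 < eta & forall t, S t -> t < eta -> t <= 0)].
Proof.
move=> St t0.
have [[eta eta0 iso]|acc] :=
    pselect (exists2 eta, 0 < eta & forall t, S t -> t < eta -> t <= 0).
  by exists (fun=> t); split=> //; right; exists eta.
have /choice[f fP] n : exists s, [/\ S s, 0 < s & s < n.+1%:R^-1].
  apply: contrapT => nex; apply: acc; exists n.+1%:R^-1 => // s Ss sn.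
  by rewrite leNgt; apply/negP => s0; apply: nex; exists s.
(* The running minimum of [f] is nonincreasing, stays below [f], and remains in [S] because each
   minimum is one of its arguments. *)
pose s := fix s n := if n is m.+1 then Num.min (s m) (f n) else f 0%N.
have sf n : s n <= f n by case: n => [|n] //=; rewrite ge_min lexx orbT.
have sS n : S (s n) /\ 0 < s n.
  elim: n => [|n [IH1 IH2]] /=; first by have [] := fP 0%N.
  by have [Sf f0 _] := fP n.+1; case: (leP (s n) (f n.+1)).
exists s; split=> [n|n|m n|]; [by have [] := sS n|by have [] := sS n| |].
- elim: n => [|n IH]; first by rewrite leqn0 => /eqP ->.
  rewrite leq_eqVlt => /predU1P[->//|]; rewrite ltnS => /IH.
  by apply: le_trans; rewrite /= ge_min lexx.
- left=> eps /invS_lt[n neps]; exists n; have [_ _ fn] := fP n.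
  by rewrite (le_lt_trans (sf n))// (lt_trans fn).
Qed.

End Metrics.

(** * Ultrametrics from decreasing sequences of equivalence relations *)

Section Levels.
Context {R : realType} (T : Type) (E : nat -> T -> T -> Prop).
Hypothesis E_refl : forall n x, E n x x.
Hypothesis E_sym : forall n x y, E n x y -> E n y x.
Hypothesis E_trans : forall n x y z, E n x y -> E n y z -> E n x z.
Hypothesis E_nested : forall n x y, E n.+1 x y -> E n x y.
Hypothesis E_sep : forall x y, (forall n, E n x y) -> x = y.
Variable s : nat -> R.
Hypothesis s_gt0 : forall n, 0 < s n.
Hypothesis s_noninc : forall m n, (m <= n)%N -> s n <= s m.

Lemma levels_antitone m n x y : (m <= n)%N -> E n x y -> E m x y.
Proof.
elim: n => [|n IH]; first by rewrite leqn0 => /eqP ->.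
by rewrite leq_eqVlt => /predU1P[->//|]; rewrite ltnS => /IH + /E_nested; exact.
Qed.

Lemma least_nat (P : nat -> Prop) : (exists n, P n) ->
  exists2 n, P n & forall m, (m < n)%N -> ~ P m.
Proof.
move=> [n Pn]; have ex : exists n, `[< P n >] by exists n; apply/asboolP.
case: (ex_minnP ex) => m /asboolP Pm min; exists m => // k km Pk.
by have := min k; rewrite leqNgt km => /(_ (asboolT Pk)).
Qed.

(** A specification rather than a function: the first level [n] separating [x] from [y] exists only
    classically, so [d] is obtained by choice. *)
Definition is_level_metric (d : T -> T -> R) : Prop :=
  forall x y, x = y /\ d x y = 0 \/
    exists n, [/\ d x y = s n, ~ E n x y & forall m, (m < n)%N -> E m x y].

Lemma level_metric_exists : exists d, is_level_metric d.
Proof.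
suff /choice[f fP] : forall p : T * T, exists r, p.1 = p.2 /\ r = 0 \/
    exists n, [/\ r = s n, ~ E n p.1 p.2 & forall m, (m < n)%N -> E m p.1 p.2].
  by exists (fun x y => f (x, y)) => x y; have := fP (x, y).
case=> x y /=; have [/E_sep->|] := pselect (forall n, E n x y).
  by exists 0; left.
move=> /existsNP/least_nat[n En Em].
by exists (s n); right; exists n; split=> // m /Em /contrapT.
Qed.

Variable d : T -> T -> R.
Hypothesis dP : is_level_metric d.

Lemma level_metric_notE n x y : ~ E n x y -> s n <= d x y.
Proof.
move=> En; have [[xy _]|[m [-> _ Em]]] := dP x y; first by rewrite xy in En.
by apply: s_noninc; rewrite leqNgt; apply/negP => /Em.
Qed.

(** Level [n] itself may or may not separate the points: the first separating level is at least [n],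
    and [s] is nonincreasing. *)
Lemma level_metric_E n x y : (forall m, (m < n)%N -> E m x y) -> d x y <= s n.
Proof.
move=> En; have [[_ ->]|[m [-> Em _]]] := dP x y; first exact: ltW.
by apply: s_noninc; rewrite leqNgt; apply/negP => /En.
Qed.

Lemma level_metric_ultra : is_ultrametric d.
Proof.
have ge0 x y : 0 <= d x y.
  by have [[_ ->//]|[n [-> _ _]]] := dP x y; exact: ltW.
have xx x : d x x = 0 by have [[]//|[n [_ /(_ (E_refl n x))]]] := dP x x.
have ultra x y z : d x y <= Num.max (d x z) (d z y).
  have [[_ ->]|[n [-> En _]]] := dP x y; first by rewrite le_max ge0.
  rewrite le_max.
  (* If level [n] separates [x] from [y], transitivity makes it separate [z] from one of them. *)
  have [xz|/level_metric_notE->//] := pselect (E n x z).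
  have [zy|/level_metric_notE->//] := pselect (E n z y); last by rewrite orbT.
  by case: En; exact: E_trans zy.
have sym_le x y : d x y <= d y x.
  have [[_ ->//]|[n [-> En _]]] := dP x y.
  by apply: level_metric_notE => /E_sym.
split=> //; split=> //.
- move=> x y; split=> [dxy|-> //].
  have [[]//|[n [sn _ _]]] := dP x y.
  by have := s_gt0 n; rewrite -sn dxy ltxx.
- by move=> x y; apply/eqP; rewrite eq_le !sym_le.
- move=> x y z; apply: le_trans (ultra x y z) _.
  by rewrite ge_max lerDl lerDr !ge0.
Qed.

(** Take the least level [n] at which the class of [x] misses [A]. A point of [A] related to [x] at
    all earlier levels is at distance at most [s n], and every point of [A] is at distance at least
    [s n]. *)
Lemma level_metric_nearest (A : set T) x : A !=set0 ->
  (exists n, forall a, A a -> ~ E n x a) ->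
  exists2 a, A a & forall b, A b -> d x a <= d x b.
Proof.
move=> [a0 Aa0] /least_nat[n far near].
have [a Aa En] : exists2 a, A a & forall m, (m < n)%N -> E m x a.
  (* For [n = 0] there are no earlier levels, and any point of [A] serves. *)
  case: n far near => [|n] far near; first by exists a0.
  have /existsNP[a /not_implyP[Aa /contrapT Ena]] := near n (ltnSn n).
  by exists a => // m mn; exact: levels_antitone Ena.
exists a => // b Ab; rewrite (le_trans (level_metric_E En))//.
exact: level_metric_notE (far b Ab).
Qed.

End Levels.

(** * Equivalence relations given by [d]-balls of small [rho]-diameter *)

Section SmallBalls.
Context {R : realType} (X : topologicalType) (d rho : X -> X -> R).
Hypothesis ud : is_ultrametric d.
Hypothesis mrho : is_metric rho.
Hypothesis d_rho : finer d rho.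

Definition small_ball (n : nat) (x : X) (t : R) : Prop :=
  forall y z, d x y < t -> d x z < t -> rho y z < n.+1%:R^-1.

Definition same_small_ball (n : nat) (x y : X) : Prop :=
  exists2 t, d x y < t & small_ball n x t.

(** Every point of an ultrametric ball is a centre of it. *)
Lemma small_ball_center n x y t : d x y < t -> small_ball n x t -> small_ball n y t.
Proof.
move=> xy xt; have ball z : d y z < t -> d x z < t.
  by move=> yz; rewrite (le_lt_trans (ud.2 x z y))// gt_max xy.
by move=> z w /ball xz /ball; exact: xt.
Qed.

Lemma small_ball_exists n x : exists2 t, 0 < t & small_ball n x t.
Proof.
have eps0 : 0 < n.+1%:R^-1 / 2 :> R by rewrite divr_gt0.
have [t t0 tP] := d_rho x eps0; exists t => // y z /tP xy /tP xz.
rewrite (le_lt_trans (is_metric_triangle mrho y z x))//.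
by rewrite (is_metric_sym mrho) (splitr n.+1%:R^-1) ltrD.
Qed.

Lemma same_small_ball_refl n x : same_small_ball n x x.
Proof.
by have [t t0 xt] := small_ball_exists n x; exists t; rewrite // (is_metric_xx ud.1).
Qed.

Lemma same_small_ball_sym n x y : same_small_ball n x y -> same_small_ball n y x.
Proof.
move=> [t xy xt]; exists t; first by rewrite (is_metric_sym ud.1).
exact: small_ball_center xt.
Qed.

(** Both small balls contain [y], so they are nested; the one of larger radius contains [x] and
    [z]. *)
Lemma same_small_ball_trans n x y z :
  same_small_ball n x y -> same_small_ball n y z -> same_small_ball n x z.
Proof.
move=> [t xy xt] [v yz yv]; have [tv|vt] := leP t v.
  have xyv : d x y < v by exact: lt_le_trans xy tv.
  exists v; first by rewrite (le_lt_trans (ud.2 x z y))// gt_max xyv.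
  by apply: small_ball_center yv; rewrite (is_metric_sym ud.1).
have yzt : d y z < t by exact: lt_trans yz vt.
by exists t => //; rewrite (le_lt_trans (ud.2 x z y))// gt_max xy.
Qed.

Lemma same_small_ball_nested n x y :
  same_small_ball n.+1 x y -> same_small_ball n x y.
Proof.
move=> [t xy xt]; exists t => // z w xz xw; rewrite (lt_le_trans (xt _ _ xz xw))//.
by rewrite lef_pV2 ?posrE ?ltr0n// ler_nat.
Qed.

Lemma same_small_ball_lt n x y : same_small_ball n x y -> rho x y < n.+1%:R^-1.
Proof.
move=> [t xy]; apply => //; rewrite (is_metric_xx ud.1).
by apply: le_lt_trans xy; exact: is_metric_ge0 ud.1 x y.
Qed.

Lemma same_small_ball_sep x y : (forall n, same_small_ball n x y) -> x = y.
Proof.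
move=> xy; apply/(is_metric_eq0 mrho); apply/eqP; rewrite eq_le.
rewrite (is_metric_ge0 mrho) andbT leNgt; apply/negP => /invS_lt[n].
by rewrite ltNge ltW//; exact: same_small_ball_lt.
Qed.

End SmallBalls.

(** * A compatible ultrametric with nearest points in closed sets *)

Definition proximinal (R : realType) (T : Type) (d : T -> T -> R)
    (A : set T) : Prop :=
  forall x, exists2 a, A a & forall b, A b -> d x a <= d x b.

(** [d'] is the level metric of the relations [same_small_ball] with values [s n] in [S]. A bound
    [d' x y < s n] forces [rho x y < n.+1%:R^-1], so [d'] inherits completeness from [rho], and the
    class of a point off a closed set misses that set at some level. *)
Lemma adapted_ultrametric (R : realType) (S : set R) (X : topologicalType)
    (d rho : X -> X -> R) :
  range_set S -> UM X S d -> is_metric rho -> generates_topology rho ->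
  exists d', [/\ UM X S d', complete_metric rho -> complete_metric d' &
    forall A, closed A -> A !=set0 -> proximinal d' A].
Proof.
move=> [S_ge0 S0] UMd mrho grho; have [ud Sd gd] := UMd.
(* If [S] has no positive element, [d] vanishes and already has all the properties. *)
have [[t [St t0]]|trivS] := pselect (exists t, S t /\ 0 < t); last first.
  have d0 x y : d x y = 0.
    apply/eqP; rewrite eq_le (is_metric_ge0 ud.1) andbT leNgt; apply/negP => xy.
    by apply: trivS; exists (d x y).
  exists d; split=> //.
    by move=> _ u _; exists (u 0%N) => eps eps0; exists 0%N => n _; rewrite d0.
  by move=> A _ [a Aa] x; exists a => // b _; rewrite !d0.
have [s [sS s_gt0 s_noninc s_lim]] := range_set_sequence St t0.
have d_rho := generates_finer gd mrho grho.
have rho_d := generates_finer grho ud.1 gd.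
pose E := same_small_ball d rho.
have E_refl n x : E n x x by exact: same_small_ball_refl.
have [d' d'P] := level_metric_exists (same_small_ball_sep ud mrho (rho := rho)) s.
have ud' : is_ultrametric d'.
  apply: (level_metric_ultra (E := E)) s_noninc _ d'P => //.
  - exact: same_small_ball_sym.
  - exact: same_small_ball_trans.
have d'_E n x y : d' x y < s n -> E n x y.
  move=> xy; apply: contrapT => /(level_metric_notE E_refl s_noninc d'P).
  by rewrite leNgt xy.
have d_d' : finer d d'.
  (* If [s] tends to 0, a small ball for level [n] is related to [x] at all levels up to [n]. If 0
     is isolated in [S], a [d]-ball of radius [eta] is a single point. *)
  move=> x eps eps0; case: s_lim => [/(_ _ eps0)[n sn]|[eta eta0 iso]].
    have [v v0 xv] := small_ball_exists mrho d_rho n x; exists v => // y xy.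
    rewrite (le_lt_trans _ sn)//; apply: (level_metric_E s_gt0 s_noninc d'P).
    move=> m /ltnW mn; apply: (levels_antitone _ mn); last by exists v.
    exact: same_small_ball_nested.
  exists eta => // y /(iso _ (Sd x y)) xy.
  have /(is_metric_eq0 ud.1)-> : d x y = 0.
    by apply/eqP; rewrite eq_le xy (is_metric_ge0 ud.1).
  by rewrite (is_metric_xx ud'.1).
have d'_rho : finer d' rho.
  move=> x eps /invS_lt[n neps]; exists (s n) => // y /d'_E.
  by move=> /(same_small_ball_lt ud)/lt_trans; exact.
have gd' : generates_topology d'.
  (* [d'] is finer than [d] by passing through [rho]. *)
  apply: finer_generates gd d_d' _ => x eps /(rho_d x)[v /(d'_rho x)[w w0 wv] vd].
  by exists w => // y /wv /vd.
exists d'; split.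
- split=> // x y; have [[_ ->//]|[n [-> _ _]]] := d'P x y; exact: sS.
- apply: complete_transfer => //; first by case: ud'.
    exact: generates_finer ud'.1 gd'.
  move=> u uC eps /invS_lt[n neps]; have [N uN] := uC _ (s_gt0 n).
  exists N => p q Np Nq; apply: lt_trans neps.
  by apply: (same_small_ball_lt ud); apply: d'_E; exact: uN.
- move=> A cA A0 x; have [Ax|Ax] := pselect (A x).
    exists x => // b _; rewrite (is_metric_xx ud'.1).
    exact: is_metric_ge0 ud'.1 _ _.
  apply: (level_metric_nearest E_refl _ s_gt0 s_noninc d'P A0).
    exact: same_small_ball_nested.
  (* Once [n.+1%:R^-1 < r], a point of [A] related to [x] at level [n] would be [rho]-closer to [x]
     than the gap [r]. *)
  have [r r0 far] := closed_gap grho cA Ax; have [n nr] := invS_lt r0.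
  exists n => a /far ra /(same_small_ball_lt ud) xa.
  by have := lt_trans (le_lt_trans ra xa) nr; rewrite ltxx.
Qed.

(** * Retraction onto [A] and gluing of the two ultrametrics *)

Section Extension.
Context {R : realType} (X : topologicalType) (A : set X).
Variables (d : X -> X -> R) (e : set_type A -> set_type A -> R).
Hypothesis ud : is_ultrametric d.
Hypothesis gd : generates_topology d.
Hypothesis ue : is_ultrametric e.
Hypothesis geA : generates_topology e.
Hypothesis proxA : proximinal d A.
Variable a0 : set_type A.

Definition nearest_points (x : X) : set (set_type A) :=
  [set a | forall b : set_type A, d x (set_val a) <= d x (set_val b)].

(** The choice depends on [x] only through the set [nearest_points x], so points with the same
    nearest points have the same image. [a0] is the default for an empty set, a case that [proxA]
    excludes. *)
Definition retract (x : X) : set_type A := xget a0 (nearest_points x).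

Definition gap (x : X) : R := d x (set_val (retract x)).

(* The pullback of an ultrametric on the quotient [X / A]. *)
Definition quotient_dist (x y : X) : R :=
  Num.min (d x y) (Num.max (gap x) (gap y)).

(** The [e]-term measures distances in [A] but cannot separate a fibre of [retract]; [quotient_dist]
    separates all points except those of [A] from each other. *)
Definition glued_dist (x y : X) : R :=
  Num.max (e (retract x) (retract y)) (quotient_dist x y).

Let md := ud.1.
Let me := ue.1.

Lemma gap_le x (b : set_type A) : gap x <= d x (set_val b).
Proof.
rewrite /gap /retract; case: xgetP => [a _ /(_ b)//|noa].
have [a Aa aP] := proxA x; case: (noa (SigSub (mem_set Aa))) => c.
exact/aP/set_valP.
Qed.

Lemma gap_ge0 x : 0 <= gap x.
Proof. exact: is_metric_ge0 md _ _. Qed.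

Lemma retract_id (a : set_type A) : retract (set_val a) = a.
Proof.
apply/esym/val_inj/(is_metric_eq0 md)/eqP; rewrite eq_le (is_metric_ge0 md) andbT.
by rewrite (le_trans (gap_le (set_val a) a))// (is_metric_xx md).
Qed.

Lemma gap_set_val (a : set_type A) : gap (set_val a) = 0.
Proof. by rewrite /gap retract_id (is_metric_xx md). Qed.

Lemma gap_eq0 x : gap x = 0 -> x = set_val (retract x).
Proof. by move/(is_metric_eq0 md). Qed.

Lemma gap_le_max x y : gap x <= Num.max (d x y) (gap y).
Proof. exact: le_trans (gap_le x (retract y)) (ud.2 _ _ _). Qed.

(** Each [a] in [A] satisfies [d x y < gap x <= d x a], so the isosceles property gives
    [d y a = d x a]: [x] and [y] have the same nearest points. *)
Lemma retract_locally_constant x y : d x y < gap x -> retract x = retract y.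
Proof.
move=> xy; rewrite /retract; congr (xget a0 _).
have dE (a : set_type A) : d y (set_val a) = d x (set_val a).
  by apply: ultrametric_isosceles ud _; exact: lt_le_trans (gap_le x a).
by apply/seteqP; split=> a ha b; have := ha b; rewrite !dE.
Qed.

(** Either the retracts coincide, or both gaps are at most [d x y] and the path from [retract x]
    through [x] and [y] to [retract y] has no longer step. *)
Lemma retract_lipschitz x y :
  d (set_val (retract x)) (set_val (retract y)) <= d x y.
Proof.
have [xy|xy] := ltP (d x y) (gap x).
  by rewrite (retract_locally_constant xy) (is_metric_xx md) (is_metric_ge0 md).
have [yx|yx] := ltP (d y x) (gap y).
  by rewrite (retract_locally_constant yx) (is_metric_xx md) (is_metric_ge0 md).
rewrite (le_trans (ud.2 _ _ x))// ge_max (is_metric_sym md) xy.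
by rewrite (le_trans (ud.2 _ _ y))// ge_max lexx (is_metric_sym md x y) yx.
Qed.

Lemma quotient_dist_sym x y : quotient_dist x y = quotient_dist y x.
Proof. by rewrite /quotient_dist (is_metric_sym md) maxC. Qed.

Lemma quotient_dist_ge0 x y : 0 <= quotient_dist x y.
Proof. by rewrite le_min (is_metric_ge0 md) le_max gap_ge0. Qed.

Lemma gap_le_quotient x y : gap x <= Num.max (quotient_dist x y) (gap y).
Proof.
have := gap_le_max x y; rewrite /quotient_dist !le_max le_min le_max lexx andbT.
by case/orP => ->; rewrite ?orbT.
Qed.

Lemma quotient_dist_ultra x y z :
  quotient_dist x y <= Num.max (quotient_dist x z) (quotient_dist z y).
Proof.
(* By symmetry the larger of the two [d]-distances may be taken as [d w v]. Either
   [quotient_dist w v] equals it and bounds [d u v], or it equals the larger gap of [w] and [v], and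
   [gap u] is bounded through [gap_le_quotient]. *)
have main u v w : d u w <= d w v ->
    quotient_dist u v <= Num.max (quotient_dist u w) (quotient_dist w v).
  move=> uwv; have uv : d u v <= d w v.
    by rewrite (le_trans (ud.2 u v w))// ge_max uwv lexx.
  have [wv|wv] := leP (d w v) (Num.max (gap w) (gap v)).
    rewrite le_max; apply/orP; right.
    by rewrite {2}/quotient_dist (min_idPl wv) ge_min uv.
  have qE : quotient_dist w v = Num.max (gap w) (gap v).
    by rewrite /quotient_dist (min_idPr (ltW wv)).
  rewrite qE ge_min; apply/orP; right; rewrite ge_max; apply/andP; split.
    have := gap_le_quotient u w.
    by rewrite !le_max => /orP[->|->]; rewrite ?orbT.
  by rewrite !le_max lexx !orbT.
have [xzy|/ltW zyx] := leP (d x z) (d z y); first exact: main.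
rewrite quotient_dist_sym maxC (quotient_dist_sym z) (quotient_dist_sym x).
by apply: main; rewrite (is_metric_sym md y) (is_metric_sym md z x).
Qed.

Lemma glued_dist_ultra : is_ultrametric glued_dist.
Proof.
have ultra x y z : glued_dist x y <= Num.max (glued_dist x z) (glued_dist z y).
  rewrite ge_max; apply/andP; split.
    have := ue.2 (retract x) (retract y) (retract z).
    by rewrite !le_max => /orP[->|->]; rewrite ?orbT.
  have := quotient_dist_ultra x y z.
  by rewrite !le_max => /orP[->|->]; rewrite ?orbT.
have ge0 x y : 0 <= glued_dist x y by rewrite le_max quotient_dist_ge0 orbT.
split=> //; split=> // [x y|x y|x y z].
- split=> [xy0|->]; last first.
    rewrite /glued_dist /quotient_dist (is_metric_xx me) (is_metric_xx md).
    by rewrite (min_idPl _) ?maxxx ?gap_ge0.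
  have : glued_dist x y <= 0 by rewrite xy0.
  (* Either [d x y = 0], or both gaps vanish; then [x] and [y] are their own retracts, which [e]
     identifies. *)
  rewrite ge_max ge_min ge_max => /andP[exy /orP[dxy|/andP[gx gy]]].
    by apply/(is_metric_eq0 md)/eqP; rewrite eq_le dxy (is_metric_ge0 md).
  have rxy : retract x = retract y.
    by apply/(is_metric_eq0 me)/eqP; rewrite eq_le exy (is_metric_ge0 me).
  have gap0 z : gap z <= 0 -> z = set_val (retract z).
    by move=> gz; apply: gap_eq0; apply/eqP; rewrite eq_le gz gap_ge0.
  by rewrite (gap0 _ gx) (gap0 _ gy) rxy.
- by rewrite /glued_dist quotient_dist_sym (is_metric_sym me).
- by apply: le_trans (ultra x y z) _; rewrite ge_max lerDl lerDr !ge0.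
Qed.

Lemma glued_dist_extends : extends glued_dist e.
Proof.
move=> a b; rewrite /glued_dist /quotient_dist !retract_id !gap_set_val maxxx.
by rewrite (min_idPr (is_metric_ge0 md _ _)) (max_idPl (is_metric_ge0 me _ _)).
Qed.

(** Maxima and minima return one of their arguments, and [gap] is a value of [d]; no closure of [S]
    under arithmetic is involved. *)
Lemma glued_dist_valued (S : set R) :
  valued_in S d -> valued_in S e -> valued_in S glued_dist.
Proof.
move=> Sd Se x y; have Sg z : S (gap z) by exact: Sd.
have Smax u v : S u -> S v -> S (Num.max u v) by case: leP.
apply: (Smax) => //; rewrite /quotient_dist.
by case: (leP (d x y) _) => // _; exact: Smax.
Qed.

Lemma d_finer_glued : finer d glued_dist.
Proof.
move=> x eps eps0.
have [t t0 te] :=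
  generates_finer (generates_subspace (A := A) md gd) me geA (retract x) eps0.
exists (Num.min t eps) => [|y]; first by rewrite lt_min t0.
rewrite lt_min => /andP[xyt xyeps]; rewrite gt_max gt_min xyeps andbT.
by apply: te; exact: le_lt_trans (retract_lipschitz x y) xyt.
Qed.

Lemma glued_finer_d : finer glued_dist d.
Proof.
move=> x eps eps0; have [gx|gx] := ltP 0 (gap x).
  (* Below [gap x] the minimum in [quotient_dist] can only be [d x y]. *)
  exists (Num.min eps (gap x)) => [|y]; first by rewrite lt_min eps0.
  rewrite gt_max gt_min gt_max !lt_min ltxx !andbF /= orbF.
  by move=> /andP[_ /andP[]].
have xE : x = set_val (retract x).
  by apply: gap_eq0; apply/eqP; rewrite eq_le gx gap_ge0.
have [t t0 te] :=
  generates_finer geA (is_metric_sub A md)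
    (generates_subspace (A := A) md gd) (retract x) eps0.
exists (Num.min t eps) => [|y]; first by rewrite lt_min t0.
rewrite gt_max gt_min gt_max !lt_min.
move=> /andP[/andP[/te /= rxy _] /orP[/andP[]//|/andP[_ /andP[_ gy]]]].
(* Here [x] lies in [A] and [gap y < eps], so [y] is reached from [x] through [retract y]. *)
rewrite (le_lt_trans (ud.2 x y (set_val (retract y))))// gt_max {1}xE rxy.
by rewrite (is_metric_sym md).
Qed.

Lemma glued_dist_generates : generates_topology glued_dist.
Proof. exact: finer_generates gd d_finer_glued glued_finer_d. Qed.

Lemma glued_dist_complete :
  complete_metric d -> complete_metric e -> complete_metric glued_dist.
Proof.
move=> cd ce u uC.
have /ce[a ra] : cauchy_for e (retract \o u).
  move=> eps /uC[N uN]; exists N => m n Nm Nn.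
  by have := uN _ _ Nm Nn; rewrite gt_max => /andP[].
(* If the gaps stay above some [eps], then [quotient_dist] agrees with [d] at scales below [eps], so
   [u] is [d]-Cauchy. Otherwise the gaps tend to 0 and [u] converges to the limit [a] of its
   retracts. *)
have [[eps eps0 [N far]]|near] := pselect
    (exists2 eps, 0 < eps & exists N, forall n, (N <= n)%N -> eps <= gap (u n)).
  have /cd[x ux] : cauchy_for d u.
    move=> eta eta0; have minee : 0 < Num.min eta eps by rewrite lt_min eta0.
    have [M uM] := uC _ minee.
    exists (maxn M N) => m n; rewrite !geq_max => /andP[Mm Nm] /andP[Mn Nn].
    have := uM _ _ Mm Mn; rewrite gt_max gt_min gt_max !lt_min.
    move=> /andP[_ /orP[/andP[]//|/andP[/andP[_]]]].
    by rewrite ltNge far.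
  exists x => eta /(d_finer_glued x)[t t0 tD].
  have [M uM] := ux _ t0; exists M => n /uM.
  by rewrite (is_metric_sym md) (is_metric_sym glued_dist_ultra.1); exact: tD.
exists (set_val a) => eps eps0.
have [N1 rN] := ra _ eps0; have [N2 uN] := uC _ eps0.
exists (maxn N1 N2) => n; rewrite geq_max => /andP[N1n N2n].
have [m N2m um] : exists2 m, (N2 <= m)%N & gap (u m) < eps.
  apply: contrapT => nom; apply: near; exists eps => //; exists N2 => m N2m.
  by rewrite leNgt; apply/negP => um; apply: nom; exists m.
(* One small gap at an index beyond [N2] makes all later gaps small, by the Cauchy property. *)
have un : gap (u n) < eps.
  rewrite (le_lt_trans (gap_le_quotient (u n) (u m)))// gt_max um andbT.
  by have := uN _ _ N2n N2m; rewrite gt_max => /andP[].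
rewrite gt_max retract_id rN//= gt_min gt_max un gap_set_val eps0.
by rewrite orbT.
Qed.

End Extension.

(** * The extension theorem *)

(** The metric [rho] is left arbitrary so that one construction gives both claims, completeness of
    [D] being conditional on that of [rho] and [e]. *)
Lemma ultrametric_extension (R : realType) (S : set R) (X : topologicalType)
    (A : set X) (rho : X -> X -> R) (e : set_type A -> set_type A -> R) :
  range_set S -> ultrametrizable X S -> closed A -> UM (set_type A) S e ->
  is_metric rho -> generates_topology rho ->
  exists D, [/\ UM X S D, extends D e &
    complete_metric rho -> complete_metric e -> complete_metric D].
Proof.
move=> hS [d0 UMd0] cA [ue Se ge] mrho grho.
have [d [[ud Sd gd] cd proxd]] := adapted_ultrametric hS UMd0 mrho grho.
(* For empty [A] there is nothing to extend, and [d] itself is taken. *)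
have [[a Aa]|A0] := pselect (A !=set0); last first.
  exists d; split=> [//||/cd//] b.
  by case: A0; exists (set_val b); exact: set_valP.
have proxA : proximinal d A by apply: proxd => //; exists a.
pose a0 : set_type A := SigSub (mem_set Aa).
exists (glued_dist d e a0); split.
- split; [exact: glued_dist_ultra|exact: glued_dist_valued|].
  exact: glued_dist_generates.
- exact: glued_dist_extends.
- by move=> /cd; exact: glued_dist_complete.
Qed.

Theorem theorem1p2 (R : realType) (S : set R) (hS : range_set S)
    (X : topologicalType) (hX : ultrametrizable X S)
    (A : set X) (hA : closed A)
    (e : set_type A -> set_type A -> R) (he : UM (set_type A) S e) :
  (exists D : X -> X -> R, UM X S D /\ extends D e) /\
  (completely_metrizable R X -> complete_metric e ->
   exists D : X -> X -> R, [/\ UM X S D, extends D e & complete_metric D]).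
Proof.
split.
  (* Without a completeness demand, the given ultrametric serves as [rho]. *)
  have [d [ud _ gd]] := hX.
  have [D [UMD De _]] := ultrametric_extension hS hX hA he ud.1 gd.
  by exists D.
move=> [rho [mrho grho crho]] ce.
have [D [UMD De cD]] := ultrametric_extension hS hX hA he mrho grho.
by exists D; split=> //; exact: cD.
Qed.
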